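(* Let $k$ be a commutative Noetherian ring, $A$ a unital $k$-algebra with $k$-involution, and $J$ an affine cell ideal of $A$ with cell data $B$, $n$, $\psi$ and ring isomorphism $\overline{\alpha}:J\to(M_n(B),\psi)$. For $1\le i,j\le n$ let $e_{ij}=\overline{\alpha}^{-1}(E_{ij})\in J$, where $E_{ij}$ are the matrix units of $M_n(B)$. Let $I$ be the ideal of $B$ generated by the entries of $\psi$, and let $\{b_\lambda+I\mid\lambda\in\Lambda\}$ be a generating set of $B/I$ as a $k$-module. (1) $J^2=\sum_{i,j=1}^nJe_{ij}\subseteq\sum_{i,j=1}^nAe_{ij}\subseteq J=J^2+\sum_{i,j,\lambda}A\,\overline{\alpha}^{-1}(b_\lambda E_{ij})$. (2) If $B/I$ is a finitely generated $k$-module, then $J$ is a finitely generated left $A$-module. (3) $J$ is idempotent (i.e. $J^2=J$) if and only if $B=I$. (4) $J=Ae$ for some idempotent $e$ if and only if $J=Ae$ for some central idempotent $e$ if and only if $\det(\psi)$ is invertible in $B$. In this case the idempotent can be chosen to be $e=\overline{\alpha}^{-1}(\det(\psi)^{-1}\psi^+)$, where $\psi^+$ is the adjoint (adjugate) matrix of $\psi$, and $A$ decomposes as the ring direct product $A\simeq A/J\times M_n(B)$.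
   Context: For a commutative ring $B$ and $\psi\in M_n(B)$, $(M_n(B),\psi)$ denotes the additive group of $M_n(B)$ with multiplication $a*b=a\psi b$; it is an associative, possibly non-unital ring. Affine cell ideals: let $A$ be a unital $k$-algebra with a $k$-involution $i$ ($k$-linear anti-automorphism with $i^2=\mathrm{id}$). A two-sided ideal $J$ is an affine cell ideal if: (1) $i(J)=J$; (2) there are a free $k$-module $V$ of finite rank $n\ge1$ and an affine (finitely generated) commutative unital $k$-algebra $B$ with a $k$-involution $\sigma$ such that $\Delta:=V\otimes_kB$ is an $A$-$B$-bimodule, with right $B$-structure induced by $B_B$; (3) there is an $A$-$A$-bimodule isomorphism $\alpha:J\to\Delta\otimes_B\Delta'$, where $\Delta'=B\otimes_kV$ is the $B$-$A$-bimodule with left $B$-structure induced by ${}_BB$ and right $A$-structure $(b\otimes v)a:=\tau(i(a)(v\otimes b))$, $\tau:\Delta\to\Delta'$ being the flip, such that $\alpha\circ i=\theta\circ\alpha$ with $\theta(v_1\otimes b_1\otimes_Bb_2\otimes v_2)=v_2\otimes\sigma(b_2)\otimes_B\sigma(b_1)\otimes v_1$. Identify $\Delta\otimes_B\Delta'$ with $V\otimes_kB\otimes_kV$ and fix a basis $v_1,\dots,v_n$ of $V$. Then there is a matrix $\psi=(\psi_{st})\in M_n(B)$ such that the multiplication of $J$, transported via $\alpha$, is $(v_i\otimes b\otimes v_j)(v_s\otimes c\otimes v_t)=v_i\otimes b\psi_{js}c\otimes v_t$. The map $\overline{\alpha}:J\to(M_n(B),\psi)$, the composite of $\alpha$ with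 $v_i\otimes b\otimes v_j\mapsto bE_{ij}$, is an isomorphism of $k$-algebras. $B$, $n$, $\psi$ are called the cell data of $J$. *)

(* Defs.v *)
From HB Require Import structures.
From mathcomp Require Import all_boot all_order all_algebra.
From mathcomp Require Import generic_quotient.
From mathcomp Require Import boolp classical_sets functions.

Set Implicit Arguments.
Unset Strict Implicit.
Unset Printing Implicit Defensive.

Import GRing.Theory.
Local Open Scope classical_set_scope.
Local Open Scope ring_scope.

(* Unital k-algebras, given by a central ring morphism k -> A.  MathComp's
   algType is not used because it excludes the zero algebra, whereas here B and
   A / J may be zero. *)
HB.mixin Record PzRing_isKAlgebra (k : comPzRingType) A of GRing.PzRing A := {
  kalg : k -> A;
  kalg_zmod_morphism : zmod_morphism kalg;
  kalg_monoid_morphism : monoid_morphism kalg;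
  kalg_central : forall (c : k) (x : A), kalg c * x = x * kalg c
}.

#[short(type="kalgType")]
HB.structure Definition KAlgebra (k : comPzRingType) :=
  {A of GRing.PzRing A & PzRing_isKAlgebra k A}.

#[short(type="comKalgType")]
HB.structure Definition ComKAlgebra (k : comPzRingType) :=
  {A of KAlgebra k A & GRing.ComPzRing A}.

HB.instance Definition _ (k : comPzRingType) (A : kalgType k) :=
  GRing.isZmodMorphism.Build k A kalg kalg_zmod_morphism.
HB.instance Definition _ (k : comPzRingType) (A : kalgType k) :=
  GRing.isMonoidMorphism.Build k A kalg kalg_monoid_morphism.

Definition kscale (k : comPzRingType) (A : kalgType k) (c : k) (x : A) : A :=
  kalg c * x.

Definition k_involution (k : comPzRingType) (A : kalgType k) (i : A -> A) :=
  [/\ forall (c : k) (x y : A), i (kscale c x + y) = kscale c (i x) + i y,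
      forall x y : A, i (x * y) = i y * i x
    & involutive i].

Definition finsums (M : zmodType) (S : set M) : set M :=
  [set x | exists2 s : seq M, {in s, forall y, S y} & x = \sum_(y <- s) y].

(* The linear combinations of elements of S, for the action act of R on M. *)
Definition lspan (R : Type) (M : zmodType) (act : R -> M -> M) (S : set M)
    : set M :=
  finsums [set act r x | r in [set: R] & x in S].

Definition fin_gen (R : Type) (M : zmodType) (act : R -> M -> M) (N : set M) :=
  exists s : seq M, N = lspan act [set` s].

Record ideal (R : pzRingType) := Ideal {
  ideal_set :> set R;
  ideal0 : ideal_set 0;
  idealB : forall x y, ideal_set x -> ideal_set y -> ideal_set (x - y);
  idealMl : forall a x, ideal_set x -> ideal_set (a * x);
  idealMr : forall a x, ideal_set x -> ideal_set (x * a)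
}.

Section GeneratedIdeal.
Variables (R : pzRingType) (S : set R).

Definition gen_set : set R :=
  [set x | forall J : ideal R, S `<=` J -> (J : set R) x].

Fact gen_set0 : gen_set 0.
Proof. by move=> J _; apply: ideal0. Qed.
Fact gen_setB x y : gen_set x -> gen_set y -> gen_set (x - y).
Proof. by move=> Sx Sy J SJ; apply: idealB; [apply: Sx | apply: Sy]. Qed.
Fact gen_setMl a x : gen_set x -> gen_set (a * x).
Proof. by move=> Sx J SJ; apply: idealMl; apply: Sx. Qed.
Fact gen_setMr a x : gen_set x -> gen_set (x * a).
Proof. by move=> Sx J SJ; apply: idealMr; apply: Sx. Qed.

Definition gen_ideal : ideal R := Ideal gen_set0 gen_setB gen_setMl gen_setMr.

End GeneratedIdeal.

Definition noetherian (R : comPzRingType) :=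
  forall J : ideal R, exists s : seq R, J = gen_ideal [set` s] :> set R.

Section Quotient.
Variables (R : pzRingType) (J : ideal R).
Local Open Scope quotient_scope.

Lemma idealN x : (J : set R) x -> (J : set R) (- x).
Proof. by move=> Jx; rewrite -sub0r; apply: idealB => //; apply: ideal0. Qed.

Lemma idealD x y : (J : set R) x -> (J : set R) y -> (J : set R) (x + y).
Proof. by move=> Jx Jy; rewrite -{1}[y]opprK; apply: idealB => //; apply: idealN. Qed.

Definition equiv_mod : rel R := fun x y => `[< (J : set R) (x - y) >].

Lemma equiv_mod_is_equiv : equiv_class_of equiv_mod.
Proof.
split=> [x|x y|y x z].
- by apply/asboolP; rewrite subrr; apply: ideal0.
- by apply/asboolP/asboolP => /idealN; rewrite opprB.
- move=> /asboolP xy /asboolP yz; apply/asboolP.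
  by rewrite -[x](subrK y) -addrA; apply: idealD.
Qed.

Canonical equiv_mod_equiv := EquivRelPack equiv_mod_is_equiv.
Canonical equiv_mod_encModRel := defaultEncModRel equiv_mod.

Definition quot := {eq_quot equiv_mod}.
#[export] HB.instance Definition _ : EqQuotient R equiv_mod quot :=
  EqQuotient.on quot.
#[export] HB.instance Definition _ := Choice.on quot.

Lemma quotP x y : reflect ((J : set R) (x - y)) (x == y %[mod quot]).
Proof. by rewrite eqmodE; apply: asboolP. Qed.

Let q_zero : quot := lift_cst quot 0.
Let q_one : quot := lift_cst quot 1.
Let q_add := lift_op2 quot +%R.
Let q_opp := lift_op1 quot -%R.
Let q_mul := lift_op2 quot *%R.

Lemma pi_quot0 : \pi 0 = q_zero :> quot.
Proof. by rewrite /q_zero; unlock. Qed.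
Lemma pi_quot1 : \pi 1 = q_one :> quot.
Proof. by rewrite /q_one; unlock. Qed.

Lemma pi_quotN : {morph \pi_quot : x / - x >-> q_opp x}.
Proof.
move=> x; unlock q_opp; apply/eqP/quotP.
rewrite -opprD; apply: idealN; apply/quotP; exact/eqP/esym/reprK.
Qed.

Lemma pi_quotD : {morph \pi_quot : x y / x + y >-> q_add x y}.
Proof.
move=> x y; unlock q_add; apply/eqP/quotP.
rewrite opprD addrACA; apply: idealD; apply/quotP; exact/eqP/esym/reprK.
Qed.

Lemma pi_quotM : {morph \pi_quot : x y / x * y >-> q_mul x y}.
Proof.
move=> x y; unlock q_mul; apply/eqP/quotP.
set x' := repr _; set y' := repr _.
have -> : x * y - x' * y' = (x - x') * y + x' * (y - y').
  by rewrite mulrBl mulrBr addrA subrK.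
by apply: idealD; [apply: idealMr|apply: idealMl]; apply/quotP;
   exact/eqP/esym/reprK.
Qed.

Lemma quot_surj (u : quot) : exists x, u = \pi x.
Proof. by exists (repr u); rewrite reprK. Qed.

Let q_addA : associative q_add.
Proof.
by move=> u v w; have [x ->] := quot_surj u; have [y ->] := quot_surj v;
   have [z ->] := quot_surj w; rewrite -!pi_quotD addrA.
Qed.
Let q_addC : commutative q_add.
Proof.
by move=> u v; have [x ->] := quot_surj u; have [y ->] := quot_surj v;
   rewrite -!pi_quotD addrC.
Qed.
Let q_add0 : left_id q_zero q_add.
Proof.
by move=> u; have [x ->] := quot_surj u; rewrite -pi_quot0 -pi_quotD add0r.
Qed.
Let q_addN : left_inverse q_zero q_opp q_add.
Proof.
by move=> u; have [x ->] := quot_surj u;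
   rewrite -pi_quot0 -pi_quotN -pi_quotD addNr.
Qed.

#[export] HB.instance Definition _ :=
  GRing.isZmodule.Build quot q_addA q_addC q_add0 q_addN.

Let q_mulA : associative q_mul.
Proof.
by move=> u v w; have [x ->] := quot_surj u; have [y ->] := quot_surj v;
   have [z ->] := quot_surj w; rewrite -!pi_quotM mulrA.
Qed.
Let q_mul1l : left_id q_one q_mul.
Proof.
by move=> u; have [x ->] := quot_surj u; rewrite -pi_quot1 -pi_quotM mul1r.
Qed.
Let q_mul1r : right_id q_one q_mul.
Proof.
by move=> u; have [x ->] := quot_surj u; rewrite -pi_quot1 -pi_quotM mulr1.
Qed.
Let q_mulDl : left_distributive q_mul +%R.
Proof.
by move=> u v w; have [x ->] := quot_surj u; have [y ->] := quot_surj v;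
   have [z ->] := quot_surj w; rewrite -[+%R]/q_add -!(pi_quotD, pi_quotM) mulrDl.
Qed.
Let q_mulDr : right_distributive q_mul +%R.
Proof.
by move=> u v w; have [x ->] := quot_surj u; have [y ->] := quot_surj v;
   have [z ->] := quot_surj w; rewrite -[+%R]/q_add -!(pi_quotD, pi_quotM) mulrDr.
Qed.

#[export] HB.instance Definition _ := GRing.Zmodule_isPzRing.Build quot
  q_mulA q_mul1l q_mul1r q_mulDl q_mulDr.

Definition quot_pi : R -> quot := \pi_quot.

Fact quot_pi_zmod_morphism : zmod_morphism quot_pi.
Proof. by move=> x y; rewrite /quot_pi pi_quotD pi_quotN. Qed.
Fact quot_pi_monoid_morphism : monoid_morphism quot_pi.
Proof. by split; [exact: pi_quot1 | exact: pi_quotM]. Qed.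
#[export] HB.instance Definition _ :=
  GRing.isZmodMorphism.Build R quot quot_pi quot_pi_zmod_morphism.
#[export] HB.instance Definition _ :=
  GRing.isMonoidMorphism.Build R quot quot_pi quot_pi_monoid_morphism.

End Quotient.

Section QuotientAlgebra.
Variables (k : comPzRingType) (A : kalgType k) (J : ideal A).

Let q_kalg (c : k) : quot J := quot_pi J (kalg c).

Fact q_kalg_zmod_morphism : zmod_morphism q_kalg.
Proof. by move=> c d; rewrite /q_kalg !rmorphB. Qed.
Fact q_kalg_monoid_morphism : monoid_morphism q_kalg.
Proof. by split=> [|c d]; rewrite /q_kalg ?rmorph1 ?rmorphM. Qed.
Fact q_kalg_central (c : k) (x : quot J) : q_kalg c * x = x * q_kalg c.
Proof.
by have [y ->] := quot_surj x; rewrite -[pi _ _]/(quot_pi J y) -!rmorphM kalg_central.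
Qed.
HB.instance Definition _ := PzRing_isKAlgebra.Build k (quot J)
  q_kalg_zmod_morphism q_kalg_monoid_morphism q_kalg_central.

End QuotientAlgebra.

(* Affine: finitely generated as a k-algebra. *)
Definition subalgebra (k : comPzRingType) (B : kalgType k) (S : set B) :=
  [/\ forall c : k, S (kalg c), forall x y, S x -> S y -> S (x - y)
    & forall x y, S x -> S y -> S (x * y)].

Definition affine (k : comPzRingType) (B : kalgType k) :=
  exists s : seq B,
    forall S : set B, subalgebra S -> [set` s] `<=` S -> S = setT.

(* A-B-bimodules, with k acting the same way on both sides. *)
Record bimodule (k : comPzRingType) (A B : kalgType k) := Bimodule {
  bimod_sort :> zmodType;
  lact : A -> bimod_sort -> bimod_sort;
  ract : bimod_sort -> B -> bimod_sort;
  lactDl : forall a a' x, lact (a + a') x = lact a x + lact a' x;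
  lactDr : forall a x y, lact a (x + y) = lact a x + lact a y;
  lact1 : forall x, lact 1 x = x;
  lactM : forall a a' x, lact (a * a') x = lact a (lact a' x);
  ractDl : forall x y b, ract (x + y) b = ract x b + ract y b;
  ractDr : forall x b b', ract x (b + b') = ract x b + ract x b';
  ract1 : forall x, ract x 1 = x;
  ractM : forall x b b', ract x (b * b') = ract (ract x b) b';
  lract : forall a x b, ract (lact a x) b = lact a (ract x b);
  kract : forall (c : k) x, lact (kalg c) x = ract x (kalg c)
}.

Section Tensor.
Variables (R : Type) (M N : zmodType) (mr : M -> R -> M) (rn : R -> N -> N).

Definition balanced (P : zmodType) (f : M -> N -> P) :=
  [/\ forall x x' y, f (x + x') y = f x y + f x' y,
      forall x y y', f x (y + y') = f x y + f x y'
    & forall x r y, f (mr x r) y = f x (rn r y)].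

(* T, with the map t, is the tensor product over R of the right module (M, mr)
   and the left module (N, rn). *)
Definition is_tensor (T : zmodType) (t : M -> N -> T) :=
  balanced t /\
  forall (P : zmodType) (f : M -> N -> P), balanced f ->
    exists g : {additive T -> P}, (forall x y, g (t x y) = f x y) /\
      forall g' : {additive T -> P}, (forall x y, g' (t x y) = f x y) ->
        g' =1 g.

End Tensor.

Definition is_basis (k : comPzRingType) (V : lmodType k) n (v : 'I_n -> V) :=
  forall x : V, exists! c : 'I_n -> k, x = \sum_(j < n) c j *: v j.

(* Delta = V (x)_k B, Delta' = B (x)_k V and W = Delta (x)_B Delta' are given up
   to isomorphism, by the universal maps tens_VB, tens_BV and tens_DD; the module
   structures, flip and theta are then determined by their values on pure
   tensors, except for the left A-action on Delta, which is part of the data. *)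
Record affine_cell_ideal (k : comPzRingType) (A : kalgType k) (i : A -> A)
    (J : ideal A) (B : comKalgType k) (n : nat) := AffineCellIdeal {
  cell_stable : i @` J = J;

  cell_rank : (0 < n)%N;
  cell_V : lmodType k;
  cell_basis : 'I_n -> cell_V;
  cell_basisP : is_basis cell_basis;
  cell_affine : affine B;
  cell_sigma : B -> B;
  cell_sigmaP : k_involution cell_sigma;

  cell_Delta : bimodule A B;
  tens_VB : cell_V -> B -> cell_Delta;
  tens_VBP : is_tensor (fun v (c : k) => c *: v) (@kscale k B) tens_VB;
  ract_Delta : forall v b b', ract (tens_VB v b) b' = tens_VB v (b * b');

  cell_Delta' : bimodule B A;
  tens_BV : B -> cell_V -> cell_Delta';
  tens_BVP : is_tensor (fun b (c : k) => kscale c b) (fun c v => c *: v) tens_BV;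
  cell_flip : {additive cell_Delta -> cell_Delta'};
  cell_flipE : forall v b, cell_flip (tens_VB v b) = tens_BV b v;
  lact_Delta' : forall b b' v, lact b (tens_BV b' v) = tens_BV (b * b') v;
  ract_Delta' : forall b v a,
    ract (tens_BV b v) a = cell_flip (lact (i a) (tens_VB v b));

  cell_W : bimodule A A;
  tens_DD : cell_Delta -> cell_Delta' -> cell_W;
  tens_DDP : is_tensor (@ract k A B cell_Delta) (@lact k B A cell_Delta') tens_DD;
  lact_W : forall a x y, lact a (tens_DD x y) = tens_DD (lact a x) y;
  ract_W : forall x y a, ract (tens_DD x y) a = tens_DD x (ract y a);

  cell_theta : {additive cell_W -> cell_W};
  cell_thetaE : forall v1 b1 b2 v2,
    cell_theta (tens_DD (tens_VB v1 b1) (tens_BV b2 v2)) =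
    tens_DD (tens_VB v2 (cell_sigma b2)) (tens_BV (cell_sigma b1) v1);

  (* alpha is defined on all of A, but only its values on J matter *)
  cell_alpha : A -> cell_W;
  cell_alpha_bij : set_bij J [set: cell_W] cell_alpha;
  cell_alphaD : forall x y, (J : set A) x -> (J : set A) y ->
    cell_alpha (x + y) = cell_alpha x + cell_alpha y;
  cell_alphaMl : forall a x, (J : set A) x ->
    cell_alpha (a * x) = lact a (cell_alpha x);
  cell_alphaMr : forall a x, (J : set A) x ->
    cell_alpha (x * a) = ract (cell_alpha x) a;
  cell_alpha_inv : forall x, (J : set A) x ->
    cell_alpha (i x) = cell_theta (cell_alpha x)
}.

Section CellData.
Variables (k : comPzRingType) (A : kalgType k) (i : A -> A) (J : ideal A).
Variables (B : comKalgType k) (n : nat) (C : affine_cell_ideal i J B n).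

(* v_s (x) b (x) v_t, under the identification of V (x)_k B (x)_k V with
   Delta (x)_B Delta'. *)
Definition vbv (s : 'I_n) (b : B) (t : 'I_n) : cell_W C :=
  tens_DD (tens_VB (cell_basis C s) b) (tens_BV 1 (cell_basis C t)).

(* psi describes the multiplication of J transported along alpha. *)
Definition is_cell_matrix (psi : 'M[B]_n) :=
  forall (p j s t : 'I_n) (b c : B) (x y : A), (J : set A) x -> (J : set A) y ->
    cell_alpha C x = vbv p b j -> cell_alpha C y = vbv s c t ->
    cell_alpha C (x * y) = vbv p (b * psi j s * c) t.

(* f restricts on J to alpha followed by v_s (x) b (x) v_t |-> b E_st; it is
   unconstrained outside J. *)
Definition is_alphabar (f : A -> 'M[B]_n) :=
  exists2 mu : {additive cell_W C -> 'M[B]_n},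
    forall s b t, mu (vbv s b t) = b *: delta_mx s t
  & forall x, (J : set A) x -> f x = mu (cell_alpha C x).

End CellData.

(* g is the inverse of the bijection J -> N induced by f. *)
Definition inverse_on (M N : Type) (J : set M) (f : M -> N) (g : N -> M) :=
  [/\ forall y, J (g y), forall x, J x -> g (f x) = x & cancel g f].

Definition is_idempotent (R : pzRingType) (e : R) := e * e = e.
Definition is_central (R : pzRingType) (e : R) := forall x : R, e * x = x * e.

(* The additive subgroup generated by the products x * y, provided X or Y is
   closed under opposites; e.g. \sum_j A e_j is set_mul A {e_j}. *)
Definition set_mul (R : pzRingType) (X Y : set R) : set R :=
  finsums [set x * y | x in X & y in Y].

Definition left_principal (R : pzRingType) (e : R) : set R :=
  range (fun a => a * e).

Definition ring_iso (R S : pzRingType) :=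
  exists f : {rmorphism R -> S}, bijective f.

(* Main.v *)
From HB Require Import structures.
Require Import Defs.
From mathcomp Require Import all_boot all_order all_algebra.
From mathcomp Require Import boolp classical_sets functions.

Set Implicit Arguments.
Unset Strict Implicit.
Unset Printing Implicit Defensive.

Import GRing.Theory.
Local Open Scope classical_set_scope.
Local Open Scope ring_scope.

(** Transporting along the inverse [g] of the coordinate map, [J] becomes the
    additive group of matrices over the commutative ring [B], with product
    [g M * g N = g (M psi N)] and with [k] acting on the coefficients
    ([cell_twisted]).  The rest is a computation in this twisted matrix ring,
    together with the fact that [J] is a two-sided ideal of [A].

    The square of [J] consists of the matrices with entries in the ideal [I]
    generated by the entries of [psi]: every entry of [M psi N] lies in [I]
    ([ideal_square_entries]), and conversely
    [E_sj psi (a E_pt) = a psi_jp E_st] ([ideal_square_unit]).  Hence [J] is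
    idempotent exactly when [I] contains [1].  As scalars of [B] pass from one
    factor to the other, matrix units suffice as right factors
    ([ideal_square_eq]).  A coefficient is, modulo [I], a [k]-combination of the
    generators [b_l]; this gives the last equality of the first part
    ([ideal_eq_squareD]), and taking finitely many generators gives finite
    generation of [J] as a left module ([ideal_fin_gen]).

    If [J = A e] with [e] idempotent and [e = g N], then [e] is a right identity
    of [J], so [psi N = 1] and the determinant of [psi] is invertible
    ([det_unit_of_idempotent]).  If it is invertible, then [g] of the inverse of
    [psi] is a two-sided identity [e] of the two-sided ideal [J], which makes it
    a central idempotent generating [J].  The map sending [a] to its class modulo
    [J] and to [M psi], where [g M = a e], is then the decomposition of [A]
    ([inverse_ring_iso]). *)

(** * Sums of elements of a set *)

Section FiniteSums.
Variable M : zmodType.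
Implicit Types S T : set M.

Lemma mem_finsums S x : S x -> finsums S x.
Proof.
move=> Sx; exists [:: x]; last by rewrite big_seq1.
by move=> y; rewrite inE => /eqP ->.
Qed.

Lemma finsums0 S : finsums S 0.
Proof. by exists [::] => //; rewrite big_nil. Qed.

Lemma finsumsD S x y : finsums S x -> finsums S y -> finsums S (x + y).
Proof.
move=> [s Ss ->] [t St ->]; exists (s ++ t); last by rewrite big_cat.
by move=> z; rewrite mem_cat => /orP[/Ss|/St].
Qed.

Lemma finsums_min S T : T 0 -> (forall x y, T x -> T y -> T (x + y)) ->
  S `<=` T -> finsums S `<=` T.
Proof.
move=> T0 TD ST _ [s Ss ->]; rewrite big_seq.
by elim/big_ind: _ => // x /Ss /ST.
Qed.

Lemma sub_finsums S T : S `<=` T -> finsums S `<=` finsums T.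
Proof.
move=> ST; apply: finsums_min (finsums0 T) (@finsumsD T) _ => x Sx.
exact/mem_finsums/ST.
Qed.

End FiniteSums.

Lemma mem_set_mul (R : pzRingType) (X Y : set R) x y :
  X x -> Y y -> set_mul X Y (x * y).
Proof. by move=> Xx Yy; apply: mem_finsums; exists x => //; exists y. Qed.

Lemma sub_set_mul (R : pzRingType) (X X' Y Y' : set R) :
  X `<=` X' -> Y `<=` Y' -> set_mul X Y `<=` set_mul X' Y'.
Proof.
move=> sX sY; apply: sub_finsums => _ [x Xx [y Yy <-]].
by exists x; [apply: sX | exists y; [apply: sY|]].
Qed.

Lemma set_mul_sub_ideal (R : pzRingType) (J : ideal R) (X Y : set R) :
  Y `<=` J -> set_mul X Y `<=` J.
Proof.
move=> YJ; apply: finsums_min; first exact: ideal0.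
  by move=> x y; apply: idealD.
by move=> _ [x _ [y /YJ Jy <-]]; apply: idealMl.
Qed.

Lemma ideal_sum (R : pzRingType) (J : ideal R) (T : Type) (s : seq T)
    (P : pred T) (f : T -> R) :
  (forall t, P t -> (J : set R) (f t)) -> (J : set R) (\sum_(t <- s | P t) f t).
Proof.
by move=> Jf; elim/big_ind: _ => //; [apply: ideal0 | move=> x y; apply: idealD].
Qed.

Lemma quot_pi_eq (R : pzRingType) (J : ideal R) x y :
  quot_pi J x = quot_pi J y <-> (J : set R) (x - y).
Proof.
split=> [/eqP/Defs.quotP //|Jxy].
exact/eqP/Defs.quotP.
Qed.

(** * Ideals that are twisted matrix rings *)

(** Stated for the inverse [g] of the coordinate map of [J], which is additive on
    a whole group, whereas the coordinate map is constrained only on [J]. *)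
Record twisted_matrix_ideal (k : comPzRingType) (A : kalgType k) (J : ideal A)
    (B : comKalgType k) (n : nat) (psi : 'M[B]_n) (g : {additive 'M[B]_n -> A})
    : Prop := TwistedMatrixIdeal {
  twisted_range : (J : set A) = range g;
  twisted_inj : injective g;
  twistedM : forall M N, g M * g N = g (M *m psi *m N);
  twistedZ : forall (c : k) M, kscale c (g M) = g (kalg c *: M)
}.

Section TwistedMatrixIdeal.
Variables (k : comPzRingType) (A : kalgType k) (J : ideal A).
Variables (B : comKalgType k) (n : nat) (psi : 'M[B]_n).
Variables (g : {additive 'M[B]_n -> A}) (gP : twisted_matrix_ideal J psi g).

Let E : set A := [set g (delta_mx p.1 p.2) | p in [set: 'I_n * 'I_n]].
Let I : ideal B := gen_ideal [set psi p.1 p.2 | p in [set: 'I_n * 'I_n]].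
Let F (T : set B) : set A :=
  [set g (c *: delta_mx p.1 p.2) | c in T & p in [set: 'I_n * 'I_n]].

Lemma twisted_mem M : (J : set A) (g M).
Proof. by rewrite (twisted_range gP); exists M. Qed.

Lemma twistedP x : (J : set A) x -> exists M, x = g M.
Proof. by rewrite (twisted_range gP) => -[M _ <-]; exists M. Qed.

Lemma sub_units_ideal : E `<=` J.
Proof. by move=> _ [p _ <-]; apply: twisted_mem. Qed.

Lemma sub_scaled_units_ideal T : F T `<=` J.
Proof. by move=> _ [c _ [p _ <-]]; apply: twisted_mem. Qed.

Lemma psi_mem s t : (I : set B) (psi s t).
Proof. by move=> K; apply; exists (s, t). Qed.

Lemma twisted_sum_units M :
  g M = \sum_s \sum_t g (M s t *: delta_mx s t).
Proof.
rewrite [in LHS](matrix_sum_delta M) raddf_sum.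
by apply: eq_bigr => s _; rewrite raddf_sum.
Qed.

(** Since [B] is commutative, a coefficient of the right factor can be moved to
    the left one, which leaves a bare matrix unit on the right. *)
Lemma ideal_square_eq : set_mul J J = set_mul J E.
Proof.
apply/seteqP; split; last exact/sub_set_mul/sub_units_ideal.
apply: finsums_min; [exact: finsums0 | exact: finsumsD |].
move=> _ [_ /twistedP[M ->] [_ /twistedP[N ->] <-]].
rewrite (twisted_sum_units N) mulr_sumr.
elim/big_ind: _ => [||s _]; [exact: finsums0 | exact: finsumsD |].
rewrite mulr_sumr; elim/big_ind: _ => [||t _]; [exact: finsums0 | exact: finsumsD |].
rewrite (twistedM gP) -scalemxAr !scalemxAl -(twistedM gP).
by apply: mem_set_mul; [exact: twisted_mem | exists (s, t)].
Qed.

(** The product [E_sj psi (w E_pt)] isolates a multiple of the entry [(j, p)] of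
    [psi]; quantifying over the multiplier [a] makes the set of good coefficients
    an ideal of [B]. *)
Lemma ideal_square_unit w : (I : set B) w ->
  forall s t, set_mul J J (g (w *: delta_mx s t)).
Proof.
pose good : set B := [set w | forall a s t,
  set_mul J J (g ((a * w) *: delta_mx s t))].
have good0 : good 0.
  by move=> a s t; rewrite mulr0 scale0r raddf0; apply: finsums0.
have goodB x y : good x -> good y -> good (x - y).
  move=> gx gy a s t; rewrite mulrBr scalerDl raddfD -mulrN.
  apply: finsumsD; first exact: gx.
  by rewrite mulrN -mulNr; apply: gy.
have goodMl a x : good x -> good (a * x).
  by move=> gx c s t; rewrite mulrA; apply: gx.
have goodMr a x : good x -> good (x * a) by rewrite mulrC; apply: goodMl.
move=> Iw s t; rewrite -[w]mul1r.
apply: (Iw (Ideal good0 goodB goodMl goodMr)) => _ [[j p] _ <-] /= a s' t'.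
(* Only the summand indexed by [j] and [p] survives in the double sum. *)
have -> : (a * psi j p) *: delta_mx s' t'
    = delta_mx s' j *m psi *m (a *: delta_mx p t') :> 'M[B]_n.
  rewrite -scalemxAr -scalerA; congr (_ *: _); apply/matrixP=> x y.
  rewrite !mxE (bigD1 p) //= big1 => [|q qp]; last first.
    by rewrite [in X in _ * X]mxE (negPf qp) /= mulr0.
  rewrite addr0 !mxE (bigD1 j) //= big1 => [|q qj]; last first.
    by rewrite mxE (negPf qj) andbF mul0r.
  rewrite addr0 !mxE !eqxx andbT /=.
  by case: (x == s'); case: (y == t'); rewrite /= ?mulr0 ?mul0r ?mulr1 ?mul1r.
by rewrite -(twistedM gP); apply: mem_set_mul; apply: twisted_mem.
Qed.

Lemma ideal_square_entries M :
  set_mul J J (g M) -> forall s t, (I : set B) (M s t).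
Proof.
pose T : set A := [set x | exists2 N, x = g N & forall s t, (I : set B) (N s t)].
suff sT : set_mul J J `<=` T by move=> /sT[N /(twisted_inj gP) ->].
apply: finsums_min.
- exists 0; first by rewrite raddf0.
  by move=> s t; rewrite mxE; apply: ideal0.
- move=> _ _ [N ->] IN [N' -> IN']; exists (N + N'); first by rewrite raddfD.
  by move=> s t; rewrite mxE; apply: idealD.
move=> _ [_ /twistedP[N ->] [_ /twistedP[N' ->] <-]].
exists (N *m psi *m N') => [|s t]; first exact: (twistedM gP).
rewrite mxE; apply: ideal_sum => q _; apply: Defs.idealMr.
by rewrite mxE; apply: ideal_sum => r _; apply/idealMl/psi_mem.
Qed.

(** Modulo [I] a coefficient is a [k]-combination of elements of [T], and the
    part in [I] is absorbed by the square of [J]. *)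
Lemma ideal_eq_squareD (T : set B) :
  lspan (@kscale k (quot I)) (quot_pi I @` T) = setT ->
  (J : set A) = [set x + y | x in set_mul J J & y in set_mul setT (F T)].
Proof.
move=> spanT; set S := [set _ + _ | _ in _ & _ in _].
have SD x y : S x -> S y -> S (x + y).
  move=> [x1 Jx1 [x2 Fx2 <-]] [y1 Jy1 [y2 Fy2 <-]].
  exists (x1 + y1); first exact: finsumsD.
  by exists (x2 + y2); [exact: finsumsD | rewrite addrACA].
have sqS x : set_mul J J x -> S x.
  by move=> Jx; exists x => //; exists 0; [exact: finsums0 | rewrite addr0].
have FS x : set_mul setT (F T) x -> S x.
  by move=> Fx; exists 0; [exact: finsums0 | exists x => //; rewrite add0r].
have S0 : S 0 by apply/sqS/finsums0.
apply/seteqP; split; last first.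
  move=> _ [x Jx [y Fy <-]]; apply: idealD.
    by apply: set_mul_sub_ideal Jx.
  exact: set_mul_sub_ideal (@sub_scaled_units_ideal T) _ Fy.
pose good : set (quot I) := [set q | forall u, quot_pi I u = q ->
  forall s t, S (g (u *: delta_mx s t))].
have good_pi u : (forall s t, S (g (u *: delta_mx s t))) -> good (quot_pi I u).
  move=> Su v /quot_pi_eq Ivu s t; rewrite -[v](subrK u) scalerDl raddfD.
  by apply: SD (Su s t); apply/sqS/ideal_square_unit.
have goodT : lspan (@kscale k (quot I)) (quot_pi I @` T) `<=` good.
  apply: finsums_min.
  - rewrite -(raddf0 (quot_pi I)); apply: good_pi => s t.
    by rewrite scale0r raddf0.
  - move=> q r; have [u ->] := quot_surj q; have [v ->] := quot_surj r => Gu Gv.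
    rewrite -[pi _ _]/(quot_pi I u) -[pi _ v]/(quot_pi I v) -raddfD.
    apply: good_pi => s t; rewrite scalerDl raddfD.
    by apply: SD; [apply: Gu | apply: Gv].
  move=> _ [c _ [_ [u Tu <-] <-]].
  have -> : kscale c (quot_pi I u) = quot_pi I (kalg c * u) by rewrite rmorphM.
  apply: good_pi => s t; rewrite -scalerA -(twistedZ gP); apply: FS.
  by apply: mem_set_mul => //; exists u => //; exists (s, t).
move=> _ /twistedP[M ->]; rewrite twisted_sum_units.
elim/big_ind: _ => [||s _] //; elim/big_ind: _ => [||t _] //.
by apply: (goodT (quot_pi I (M s t))) => //; rewrite spanT.
Qed.

(** The square of [J] is already generated by the finitely many matrix units, so
    only the complement given by [ideal_eq_squareD] needs representatives of the
    generators of [B / I]. *)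
Lemma ideal_fin_gen :
  fin_gen (@kscale k (quot I)) setT -> fin_gen *%R J.
Proof.
move=> [s spans]; pose T : set B := [set` map repr s].
have piT : quot_pi I @` T = [set` s].
  apply/seteqP; split=> [_ [_ /mapP[q qs ->] <-]|q qs] /=.
    by rewrite /quot_pi reprK.
  by exists (repr q); [apply: map_f | rewrite /quot_pi reprK].
pose units := [seq g (delta_mx p.1 p.2) | p : 'I_n * 'I_n].
pose scaled := [seq g (c *: delta_mx p.1 p.2) | c <- map repr s,
                 p <- enum {: 'I_n * 'I_n}].
exists (units ++ scaled); apply/seteqP; split; last first.
  apply: set_mul_sub_ideal => x /=; rewrite mem_cat => /orP[/mapP[p _ ->]|].
    exact: twisted_mem.
  by move=> /allpairsP[[c p] [_ _ ->]]; apply: twisted_mem.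
rewrite (@ideal_eq_squareD T) ?piT // ideal_square_eq => _ [x Jx [y Fy <-]].
apply: finsumsD.
  apply: sub_set_mul Jx => // _ [p _ <-] /=.
  by rewrite mem_cat; apply/orP; left; apply/mapP; exists p; rewrite ?mem_enum.
apply: sub_set_mul Fy => // _ [c Tc [p _ <-]] /=.
rewrite mem_cat; apply/orP; right; apply/allpairsP.
by exists (c, p); split; rewrite ?mem_enum.
Qed.

(** The coefficient of a matrix unit can be read off as an entry, which requires
    a matrix unit to exist, whence [0 < n]. *)
Lemma ideal_idempotentP : (0 < n)%N ->
  set_mul J J = J <-> (I : set B) = setT.
Proof.
move=> n0; pose o := Ordinal n0; split=> [sqJ|IT].
  apply/seteqP; split=> // u _.
  have := @ideal_square_entries (u *: delta_mx o o).
  rewrite sqJ => /(_ (twisted_mem _) o o).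
  by rewrite !mxE !eqxx mulr1.
apply/seteqP; split; first by apply: set_mul_sub_ideal.
move=> _ /twistedP[M ->]; rewrite twisted_sum_units.
elim/big_ind: _ => [||s _]; [exact: finsums0 | exact: finsumsD |].
elim/big_ind: _ => [||t _]; [exact: finsums0 | exact: finsumsD |].
by apply: ideal_square_unit; rewrite IT.
Qed.

(** A generating idempotent is a right identity of [J], that is, a right inverse
    of [psi]. *)
Lemma det_unit_of_idempotent e :
  is_idempotent e -> (J : set A) = left_principal e ->
  exists d : B, d * \det psi = 1.
Proof.
move=> ee Je.
have /twistedP[N eN] : (J : set A) e by rewrite Je; exists 1; rewrite ?mul1r.
exists (\det N).
have : g 1%:M * e = g 1%:M.
  have : (J : set A) (g 1%:M) by apply: twisted_mem.
  by rewrite Je => -[a _ <-]; rewrite -mulrA ee.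
rewrite eN (twistedM gP) => /(twisted_inj gP); rewrite mul1mx.
by rewrite mulrC -det_mulmx => ->; rewrite det1.
Qed.

Section InvertibleDeterminant.
Variables (d : B) (d_det : d * \det psi = 1).

Let e0 := g (d *: \adj psi).

Let adj_psi : (d *: \adj psi) *m psi = 1%:M.
Proof. by rewrite -scalemxAl mul_adj_mx scale_scalar_mx d_det. Qed.

Let psi_adj : psi *m (d *: \adj psi) = 1%:M.
Proof. exact: mulmx1C. Qed.

Let e0J : (J : set A) e0. Proof. exact: twisted_mem. Qed.

Let mule0 x : (J : set A) x -> x * e0 = x.
Proof.
by move=> /twistedP[M ->]; rewrite (twistedM gP) -mulmxA psi_adj mulmx1.
Qed.

Let mul0e x : (J : set A) x -> e0 * x = x.
Proof. by move=> /twistedP[M ->]; rewrite (twistedM gP) adj_psi mul1mx. Qed.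

Lemma inverse_idempotent : is_idempotent e0.
Proof. exact: mule0. Qed.

(** An identity element of a two-sided ideal is central: both [e x] and [x e]
    lie in the ideal, so they equal [e x e]. *)
Lemma inverse_central : is_central e0.
Proof.
move=> x; rewrite -[LHS]mule0; last exact: Defs.idealMr.
by rewrite -mulrA mul0e //; apply: idealMl.
Qed.

Lemma inverse_generates : (J : set A) = left_principal e0.
Proof.
apply/seteqP; split=> [x Jx|_ [a _ <-]]; last exact: idealMl.
by exists x; rewrite ?mule0.
Qed.

(** The matrix component of [a] represents [a e0], which lies in [J]; the factor
    [psi] turns the twisted product into the ordinary one. *)
Lemma inverse_ring_iso : ring_iso A (quot J * 'M[B]_n)%type.
Proof.
have /choice[h hP] : forall a, exists M, a * e0 = g M.
  by move=> a; apply/twistedP/idealMl.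
pose f a : quot J * 'M[B]_n := (quot_pi J a, h a *m psi).
have fB : zmod_morphism f.
  move=> x y; rewrite /f raddfB; congr pair; rewrite -mulmxBl; congr (_ *m _).
  by apply: (twisted_inj gP); rewrite raddfB /= -!hP mulrBl.
have fM : monoid_morphism f.
  split=> [|x y]; rewrite /f.
    rewrite rmorph1; congr pair; rewrite -[RHS]adj_psi; congr (_ *m _).
    by apply: (twisted_inj gP); rewrite -hP mul1r.
  rewrite rmorphM; congr pair; rewrite [RHS]mulmxA; congr (_ *m _).
  apply: (twisted_inj gP); rewrite -(twistedM gP) -!hP -!mulrA.
  congr (_ * _); rewrite mul0e //; exact: idealMl.
pose fZ := GRing.isZmodMorphism.Build _ _ f fB.
pose fMm := GRing.isMonoidMorphism.Build _ _ f fM.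
pose F' : {rmorphism A -> (quot J * 'M[B]_n)%type} := HB.pack f fZ fMm.
exists F'.
(* The part [a (1 - e0)] of [a] depends only on the class of [a] modulo [J]. *)
pose f' (p : quot J * 'M[B]_n) := repr p.1 * (1 - e0) + g (p.2 *m (d *: \adj psi)).
have f_inj : injective f.
  move=> x y fxy.
  have /quot_pi_eq Jxy : quot_pi J x = quot_pi J y by case: fxy.
  have /(congr1 (mulmx^~ (d *: \adj psi))) : h x *m psi = h y *m psi by case: fxy.
  rewrite -!mulmxA psi_adj !mulmx1 => hxy.
  apply/eqP; rewrite -subr_eq0 -[x - y]mule0 // mulrBl !hP hxy subrr //.
have fK : cancel f' f.
  case=> q M; rewrite /f /f' /=; congr pair.
    rewrite -[RHS]reprK -[RHS]/(quot_pi J (repr q)); apply/quot_pi_eq.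
    rewrite mulrBr mulr1 addrAC [_ - _ - _]addrAC subrr sub0r.
    apply: idealD; last exact: twisted_mem.
    exact/idealN/idealMl.
  rewrite -[RHS]mulmx1 -adj_psi mulmxA; congr (_ *m _).
  apply: (twisted_inj gP); rewrite -hP mulrDl -mulrA mulrBl mul1r.
  by rewrite inverse_idempotent subrr mulr0 add0r mule0 //; apply: twisted_mem.
by exists f' => // x; apply: f_inj; rewrite fK.
Qed.

End InvertibleDeterminant.

End TwistedMatrixIdeal.

(** * From cell data to twisted matrices *)

Section CellCoordinates.
Variables (k : comPzRingType) (A : kalgType k) (i : A -> A) (J : ideal A).
Variables (B : comKalgType k) (n : nat) (C : affine_cell_ideal i J B n).
Variables (psi : 'M[B]_n) (psiP : is_cell_matrix C psi).
Variables (abar : A -> 'M[B]_n) (abarP : is_alphabar C abar).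
Variables (abarV : 'M[B]_n -> A) (abarVP : inverse_on J abar abarV).

Lemma abarV_mem M : (J : set A) (abarV M).
Proof. by case: abarVP. Qed.

Lemma abarD x y : (J : set A) x -> (J : set A) y -> abar (x + y) = abar x + abar y.
Proof.
case: abarP => mu _ muE Jx Jy; rewrite !muE //; last exact: idealD.
by rewrite (cell_alphaD C) // raddfD.
Qed.

Lemma abarV_zmod_morphism : zmod_morphism abarV.
Proof.
case: abarVP => gJ fK gK.
have gD M N : abarV (M + N) = abarV M + abarV N.
  rewrite -[RHS]fK; last exact: idealD.
  by rewrite abarD // !gK.
by move=> M N; apply: (addIr (abarV N)); rewrite -gD !subrK.
Qed.

Definition abarV_additive : {additive 'M[B]_n -> A} :=
  HB.pack_for {additive 'M[B]_n -> A} abarV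
    (GRing.isZmodMorphism.Build _ _ _ abarV_zmod_morphism).

(** Surjectivity of [alpha] provides a preimage of the pure tensor, and [abar]
    identifies it. *)
Lemma cell_alpha_abarV s b t :
  cell_alpha C (abarV (b *: delta_mx s t)) = vbv C s b t.
Proof.
case: abarVP => _ fK _; case: abarP => mu muv muE.
have [_ _ surj] := cell_alpha_bij C.
have [x Jx xE] := surj (vbv C s b t) I.
by rewrite -muv -xE -muE // fK.
Qed.

Lemma abarV_alpha x s b t : (J : set A) x -> cell_alpha C x = vbv C s b t ->
  x = abarV (b *: delta_mx s t).
Proof.
case: abarVP => _ fK _; case: abarP => mu muv muE Jx xE.
by rewrite -[LHS]fK // muE // xE muv.
Qed.

Lemma abarV_unitM p j s t b c :
  abarV (b *: delta_mx p j) * abarV (c *: delta_mx s t)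
  = abarV ((b *: delta_mx p j) *m psi *m (c *: delta_mx s t)).
Proof.
rewrite (abarV_alpha (idealMl _ (abarV_mem _))
  (psiP (abarV_mem _) (abarV_mem _) (cell_alpha_abarV p b j)
        (cell_alpha_abarV s c t))).
congr abarV; apply/matrixP=> x y; rewrite !mxE (bigD1 s) //= big1 => [|q qs]; last first.
  by rewrite [in X in _ * X]mxE [in X in _ * X]mxE (negPf qs) /= !mulr0.
rewrite addr0 !mxE (bigD1 j) //= big1 => [|q qj]; last first.
  by rewrite !mxE (negPf qj) andbF mulr0 mul0r.
rewrite addr0 !mxE !eqxx andbT /=.
by case: (x == p); case: (y == t); rewrite /= ?(mulr0, mul0r, mulr1).
Qed.

(** The ground ring acts in the same way on both sides of [Delta], hence on the
    coefficient of a pure tensor. *)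
Lemma abarV_unitZ (c : k) s t b :
  kscale c (abarV (b *: delta_mx s t)) = abarV (kalg c *: (b *: delta_mx s t)).
Proof.
rewrite scalerA; apply: abarV_alpha; first by apply/idealMl/abarV_mem.
rewrite (cell_alphaMl C _ (abarV_mem _)) cell_alpha_abarV /vbv lact_W kract.
by rewrite ract_Delta mulrC.
Qed.

Lemma cell_twisted : twisted_matrix_ideal J psi abarV_additive.
Proof.
have [gJ fK gK] := abarVP.
split.
- apply/seteqP; split=> [x Jx|_ [M _ <-]]; last exact: gJ.
  by exists (abar x) => //; apply: fK.
- exact: can_inj gK.
- move=> M N; rewrite (matrix_sum_delta M) (matrix_sum_delta N) !pair_big.
  rewrite raddf_sum mulr_suml !mulmx_suml [RHS]raddf_sum.
  apply: eq_bigr => p _; rewrite raddf_sum mulmx_sumr mulr_sumr [RHS]raddf_sum.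
  by apply: eq_bigr => q _; apply: abarV_unitM.
- move=> c M; rewrite (matrix_sum_delta M) !pair_big /kscale.
  rewrite raddf_sum mulr_sumr scaler_sumr [RHS]raddf_sum.
  by apply: eq_bigr => p _; apply: abarV_unitZ.
Qed.

End CellCoordinates.

(** * The structure of an affine cell ideal *)

Theorem proposition3p5 (k : comPzRingType) (k_noeth : noetherian k)
    (A : kalgType k) (i : A -> A) (i_inv : k_involution i)
    (J : ideal A) (B : comKalgType k) (n : nat)
    (C : affine_cell_ideal i J B n)
    (psi : 'M[B]_n) (psiP : is_cell_matrix C psi)
    (abar : A -> 'M[B]_n) (abarP : is_alphabar C abar)
    (abarV : 'M[B]_n -> A) (abarVP : inverse_on J abar abarV)
    (Lambda : Type) (b : Lambda -> B) :
  let e s t := abarV (delta_mx s t) in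
  let E : set A := [set e p.1 p.2 | p in [set: 'I_n * 'I_n]] in
  let I : ideal B := gen_ideal [set psi p.1 p.2 | p in [set: 'I_n * 'I_n]] in
  let F : set A := [set abarV (b l *: delta_mx p.1 p.2) |
                     l in [set: Lambda] & p in [set: 'I_n * 'I_n]] in
  lspan (@kscale k (quot I)) (range (fun l => quot_pi I (b l))) = setT ->
  [/\
    [/\ set_mul J J = set_mul J E,
        set_mul J E `<=` set_mul setT E,
        set_mul setT E `<=` J
      & J = [set x + y | x in set_mul J J & y in set_mul setT F] :> set A],
    fin_gen (@kscale k (quot I)) setT -> fin_gen *%R J,
    set_mul J J = J <-> I = setT :> set B
  & [/\
      (exists e0 : A, is_idempotent e0 /\ J = left_principal e0 :> set A) <->
        (exists e0 : A,
           [/\ is_idempotent e0, is_central e0 & J = left_principal e0 :> set A]),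
      (exists e0 : A,
           [/\ is_idempotent e0, is_central e0 & J = left_principal e0 :> set A]) <->
        (exists d : B, d * \det psi = 1)
    & forall d : B, d * \det psi = 1 ->
        let e0 := abarV (d *: \adj psi) in
        [/\ is_idempotent e0, is_central e0, J = left_principal e0 :> set A
          & ring_iso A (quot J * 'M[B]_n)%type]]].
Proof.
move=> e E I F spanT.
pose g := abarV_additive abarP abarVP.
have gP : twisted_matrix_ideal J psi g := cell_twisted psiP abarP abarVP.
have FE : F = [set g (c *: delta_mx p.1 p.2) |
               c in range b & p in [set: 'I_n * 'I_n]].
  apply/seteqP; split=> [_ [l _ [p _ <-]]|_ [_ [l _ <-] [p _ <-]]].
    by exists (b l); [exists l | exists p].
  by exists l => //; exists p.
have EJ : E `<=` J by apply: (sub_units_ideal gP).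
split; first split.
- exact: (ideal_square_eq gP).
- exact: sub_set_mul.
- exact: set_mul_sub_ideal.
- rewrite FE; apply: (ideal_eq_squareD gP).
  by rewrite image_comp.
- exact: (ideal_fin_gen gP).
- exact: (ideal_idempotentP gP (cell_rank C)).
have unitP : (exists e0 : A, is_idempotent e0 /\ (J : set A) = left_principal e0) ->
    exists d : B, d * \det psi = 1.
  by case=> e0 [e0e0 Je0]; apply: (det_unit_of_idempotent gP) e0e0 Je0.
have detP d : d * \det psi = 1 -> let e0 := abarV (d *: \adj psi) in
    [/\ is_idempotent e0, is_central e0, (J : set A) = left_principal e0
      & ring_iso A (quot J * 'M[B]_n)%type].
  move=> d_det; split.
  - exact: (inverse_idempotent gP d_det).
  - exact: (inverse_central gP d_det).
  - exact: (inverse_generates gP d_det).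
  - exact: (inverse_ring_iso gP d_det).
have weaken : (exists e0 : A,
      [/\ is_idempotent e0, is_central e0 & (J : set A) = left_principal e0]) ->
    exists e0 : A, is_idempotent e0 /\ (J : set A) = left_principal e0.
  by case=> e0 [? _ ?]; exists e0.
have central : (exists d : B, d * \det psi = 1) -> exists e0 : A,
    [/\ is_idempotent e0, is_central e0 & (J : set A) = left_principal e0].
  by case=> d /detP[? ? ? _]; exists (abarV (d *: \adj psi)).
split; [split=> [/unitP/central //|//] | split=> [/weaken/unitP //|//] | exact: detP].
Qed.
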